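(* Let $k\ge1$. For every $j\ge1$ and $n\ge\max\{0,j-k\}$, \[ (n+k+j+2)\,\alpha_{n+1,j+1}^{(k)}=(n-j+k+1)\,\alpha_{n,j+1}^{(k)}+(n+k+j)\,\alpha_{n,j}^{(k)}-(n-j+k+1)\,\alpha_{n+1,j}^{(k)} . \]
   Context: $H^2(\mathbb D^2)$ is the Hardy space over the bidisk, in which the monomials $z^aw^b$ ($a,b\ge0$) form an orthonormal basis. For $k\ge1$ let $p_k=(z-w)^k$ and let $M_k=[p_k]$ be the closure of $p_k\mathbb C[z,w]$ in $H^2(\mathbb D^2)$. For $n\ge0$ let $A^n=\left(\langle p_kz^iw^{n-i},p_kz^jw^{n-j}\rangle\right)_{i,j=0}^n$ (a real symmetric positive definite Toeplitz matrix), let $A^n_{i,j}$ be the algebraic (signed) cofactor of its $(i,j)$ entry (indices from $0$ to $n$; $A^0_{0,0}=1$), and put $D_0=1$, $D_n=\det A^{n-1}$ for $n\ge1$. Set \[ \phi_n=\frac{\sum_{l=0}^nA^n_{0,l}\,p_kz^lw^{n-l}}{\sqrt{D_nD_{n+1}}},\qquad \psi_n=\frac{\sum_{l=0}^nA^n_{n,l}\,p_kz^lw^{n-l}}{\sqrt{D_nD_{n+1}}}\qquad(n\ge0). \] These are orthonormal bases of $M_k\ominus zM_k$ and $M_k\ominus wM_k$ respectively. For $n\ge0$, $j\ge1$ define $\alpha_{n,j}^{(k)}=\langle w^j\phi_n,z^j\psi_n\rangle$. *)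

(* Defs.v *)
From HB Require Import structures.
From mathcomp Require Import all_boot all_order all_algebra.
From mathcomp Require Import polyXY.
From mathcomp Require Import complex.
From mathcomp Require Import all_classical all_reals all_analysis.

Set Implicit Arguments.
Unset Strict Implicit.
Unset Printing Implicit Defensive.

Import Order.TTheory GRing.Theory Num.Theory.
Import numFieldNormedType.Exports.

Local Open Scope ring_scope.

Local Open Scope classical_set_scope.

(* Keeping R[i] behind a [numClosedFieldType] lets inference find the norm
   topology that every such type carries. *)
Definition complexC (R : realType) : numClosedFieldType := R[i]%C.

(* Elements of H^2(D^2) are represented by their Taylor coefficients at the
   origin: [hcoef f a b] is the coefficient of z^a w^b, and membership in H^2
   is square summability of the coefficients. *)
Definition square_summable (R : realType) (c : nat -> nat -> complexC R) : Prop :=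
  exists M : complexC R, forall N : nat,
    \sum_(a < N) \sum_(b < N) `|c a b| ^+ 2 <= M.

Record hardy (R : realType) := Hardy {
  hcoef :> nat -> nat -> complexC R;
  hardyP : square_summable hcoef }.

(* The double series is absolutely convergent on H^2, so summing it along
   squares gives its sum. *)
Definition hdot (R : realType) (f g : hardy R) : complexC R :=
  lim ((fun N : nat => \sum_(a < N) \sum_(b < N) f a b * (g a b)^*) @ \oo).

(* C[z,w] is {poly {poly C}} with z the outer and w the inner variable:
   p`_a`_b is the coefficient of z^a w^b. *)
Notation varz := 'X.
Notation varw := 'Y.

Lemma poly_square_summable (R : realType) (p : {poly {poly complexC R}}) :
  square_summable (fun a b => p`_a`_b).
Proof.
pose F (a b : nat) : complexC R := `|p`_a`_b| ^+ 2.
exists (\sum_(a < size p) \sum_(b < sizeY p) F a b) => N.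
have F0 a b : 0 <= F a b by rewrite exprn_ge0.
have leS (G : nat -> complexC R) m n : (forall i, 0 <= G i) ->
    (forall i, (n <= i)%N -> G i = 0) -> \sum_(i < m) G i <= \sum_(i < n) G i.
  move=> G0 Gn; case: (leqP m n) => [mn|/ltnW nm]; last first.
    rewrite (big_ord_widen m (fun i => G i) nm) [leRHS]big_mkcond /=.
    apply: ler_sum => i _; case: ltnP => // ni.
    by rewrite Gn.
  rewrite (big_ord_widen n (fun i => G i) mn) [leLHS]big_mkcond /=.
  by apply: ler_sum => i _; case: ifP.
apply: (@le_trans _ _ (\sum_(a < N) \sum_(b < sizeY p) F a b)).
  apply: ler_sum => a _; apply: (leS (F a)) => // b pb.
  rewrite /F [p`_a`_b]nth_default ?normr0 ?expr0n //.
  exact: leq_trans (max_size_coefXY p a) pb.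
apply: (leS (fun a => \sum_(b < sizeY p) F a b)) => [a|a pa].
  by apply: sumr_ge0.
by apply: big1 => b _; rewrite /F [p`_a]nth_default // coef0 normr0 expr0n.
Qed.

Definition hardy_of_poly (R : realType) (p : {poly {poly complexC R}}) : hardy R :=
  Hardy (poly_square_summable p).

Definition pdot (R : realType) (p q : {poly {poly complexC R}}) : complexC R :=
  hdot (hardy_of_poly p) (hardy_of_poly q).

Lemma monomial_orthonormal (R : realType) (a b c d : nat) :
  pdot (varz ^+ a * varw ^+ b : {poly {poly complexC R}}) (varz ^+ c * varw ^+ d)
  = ((a == c) && (b == d))%:R.
Proof.
have cfE (m n i j : nat) :
    ('X^m * 'Y ^+ n : {poly {poly complexC R}})`_i`_j = ((i == m) && (j == n))%:R.
  by rewrite -rmorphXn coefMC coefXn mulr_natl coefMn coefXn; case: (i == m);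
    case: (j == n).
apply: lim_near_cst => //.
exists (maxn a.+1 b.+1) => // N /=; rewrite geq_max => /andP[aN bN].
rewrite (bigD1 (Ordinal aN)) //= (bigD1 (Ordinal bN)) //=.
rewrite big1 ?addr0; last first.
  move=> j /negPf; rewrite -val_eqE /= => jb.
  by rewrite cfE jb andbF mul0r.
rewrite big1 ?addr0; last first.
  move=> i /negPf; rewrite -val_eqE /= => ia.
  by apply: big1 => j _; rewrite cfE ia mul0r.
by rewrite !cfE !eqxx mul1r conjC_nat.
Qed.

Definition pk (R : realType) (k : nat) : {poly {poly complexC R}} :=
  (varz - varw) ^+ k.

Definition pkmon (R : realType) (k n i : nat) : {poly {poly complexC R}} :=
  pk R k * varz ^+ i * varw ^+ (n - i).

Definition gramA (R : realType) (k n : nat) : 'M[complexC R]_n.+1 :=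
  \matrix_(i, j) pdot (pkmon R k n i) (pkmon R k n j).

Definition gramD (R : realType) (k n : nat) : complexC R :=
  if n is m.+1 then \det (gramA R k m) else 1.

Definition phi (R : realType) (k n : nat) : {poly {poly complexC R}} :=
  (sqrtC (gramD R k n * gramD R k n.+1))^-1%:P *:
    \sum_(l < n.+1) (cofactor (gramA R k n) ord0 l)%:P *: pkmon R k n l.

Definition psi (R : realType) (k n : nat) : {poly {poly complexC R}} :=
  (sqrtC (gramD R k n * gramD R k n.+1))^-1%:P *:
    \sum_(l < n.+1) (cofactor (gramA R k n) ord_max l)%:P *: pkmon R k n l.

Definition alpha (R : realType) (k n j : nat) : complexC R :=
  pdot (varw ^+ j * phi R k n) (varz ^+ j * psi R k n).

(* Main.v *)
(* Dehomogenizing at [w = 1] turns the elements [p_k z^i w^(n-i)] into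
   [(x - 1)^k x^i], so the Gram matrices are the Toeplitz matrices of the weight
   [|1 - x|^(2k)] on the unit circle, [phi_n] is the normalized reversed Szego
   polynomial [q_n], with [q_n(0) = 1], times [(x - 1)^k], and [psi_n] is
   its reversal.  Hence, with [T = (x - 1)^(2k)], [alpha_(n,j)] is the
   coefficient of [x^(n+k+j)] in [H_n = T q_n^2 / e_n], where [e_n] is the
   coefficient of [x^k] in [T q_n].  Uniqueness of [q_n] gives
     (n+k+1) q_(n+1) = (n+k+1 + k x) q_n - x (1 - x) q_n',
     (1 - x) q_(n+1)' + (n+1) q_(n+1) = g_n q_n,  (n+k+1) e_(n+1) = g_n e_n,
   and multiplying the first by [q_n] and the second by [q_(n+1)] yields
     (1 - x) H_(n+1)' + 2(n+k+1) H_(n+1) = 2(n+k+1) H_n - x (1 - x) H_n',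
   whose coefficient at [x^(n+k+j+1)] is the recurrence. *)

Require Import Defs.
From mathcomp Require Import all_boot all_order all_algebra.
From mathcomp Require Import polyXY zify ring.
From mathcomp Require Import complex.
From mathcomp Require Import all_classical all_reals all_analysis.

Set Implicit Arguments.
Unset Strict Implicit.
Unset Printing Implicit Defensive.

Import Order.TTheory GRing.Theory Num.Theory.
Import numFieldNormedType.Exports.

Local Open Scope ring_scope.

(** * Coefficients of powers of ['X - 1] and pairings on the unit circle *)

Lemma coef_subX1_exp (K : comNzRingType) (k i : nat) :
  (('X - 1) ^+ k : {poly K})`_i = (-1) ^+ (k + i) * 'C(k, i)%:R.
Proof.
elim: k i => [|k IH] i.
  by rewrite expr0 coef1 bin0n; case: i => [|i]; rewrite ?mulr0 ?mulr1.
rewrite exprS mulrBl mul1r coefB coefXM !IH; case: i => [|i] /=.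
  by rewrite !bin0 !addn0 exprS; ring.
by rewrite binS natrD !addnS !addSn !exprS; ring.
Qed.

Lemma coef_subX1_exp_rev (K : comNzRingType) (k i : nat) : (i <= k)%N ->
  (('X - 1) ^+ k : {poly K})`_(k - i) = (-1) ^+ k * (('X - 1) ^+ k : {poly K})`_i.
Proof.
move=> ik; rewrite !coef_subX1_exp bin_sub // mulrA; congr (_ * _).
rewrite -exprD -[LHS]signr_odd -[RHS]signr_odd; congr ((-1) ^+ nat_of_bool _).
by rewrite !oddD oddB //; do 2 case: odd.
Qed.

Lemma coef_subX1_exp_gt (K : comNzRingType) (k i : nat) : (k < i)%N ->
  (('X - 1) ^+ k : {poly K})`_i = 0.
Proof. by move=> ki; rewrite coef_subX1_exp bin_small // mulr0. Qed.

Lemma conj_coef_subX1_exp (K : numClosedFieldType) (k i : nat) :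
  ((('X - 1) ^+ k : {poly K})`_i)^* = (('X - 1) ^+ k : {poly K})`_i.
Proof. by rewrite coef_subX1_exp rmorphM rmorph_nat rmorph_sign. Qed.

Lemma subX1_exp_neq0 (K : idomainType) k : (('X - 1) ^+ k : {poly K}) != 0.
Proof. by rewrite expf_neq0 // polyXsubC_eq0. Qed.

(* Pairing with [(X - 1)^k X^i] on the unit circle is coefficient extraction,
   because [(X - 1)^k] is palindromic up to the sign [(-1)^k]. *)
Lemma dot_subX1_exp (K : numClosedFieldType) (k i m : nat) (f : {poly K}) :
  (k + i <= m)%N ->
  \sum_(a < m.+1) f`_a * ((('X - 1) ^+ k * 'X^i : {poly K})`_a)^* =
  (-1) ^+ k * (('X - 1) ^+ k * f)`_(k + i).
Proof.
move=> kim; rewrite coefMr mulr_sumr.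
rewrite (big_ord_widen m.+1
  (fun a => (-1) ^+ k * ((('X - 1) ^+ k)`_(k + i - a) * f`_a))) //.
rewrite [RHS]big_mkcond; apply: eq_bigr => a _; rewrite ltnS coefMXn.
case: ltnP => [ai|ia].
  rewrite rmorph0 mulr0 ifT; last by lia.
  by rewrite coef_subX1_exp_gt ?mul0r ?mulr0 //; lia.
rewrite conj_coef_subX1_exp; case: leqP => [aki|kia]; last first.
  by rewrite coef_subX1_exp_gt ?mulr0 //; lia.
have -> : (k + i - a = k - (a - i))%N by lia.
by rewrite coef_subX1_exp_rev ?mulrA -?expr2 ?sqrr_sign ?mul1r 1?mulrC //; lia.
Qed.

(** Expands [g] in monomials and applies [dot_subX1_exp] to each, conjugate-linearly; the bound on
    [m] keeps every term within the range of summation. *)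
Lemma dot_subX1_exp_mul (K : numClosedFieldType) (k j n m : nat) (f g : {poly K}) :
  (size g <= n.+1)%N -> (k + n + j <= m)%N ->
  \sum_(a < m.+1) f`_a * ((('X - 1) ^+ k * g * 'X^j : {poly K})`_a)^* =
  (-1) ^+ k * \sum_(i < n.+1) (g`_i)^* * (('X - 1) ^+ k * f)`_(k + (i + j)).
Proof.
move=> sg kjm.
have gE : ('X - 1) ^+ k * g * 'X^j =
    \sum_(i < n.+1) g`_i *: (('X - 1) ^+ k * 'X^(i + j)).
  rewrite [in LHS](_ : g = \sum_(i < n.+1) g`_i *: 'X^i).
    rewrite mulr_sumr mulr_suml; apply: eq_bigr => i _.
    by rewrite -scalerAr -scalerAl exprD mulrA.
  rewrite -poly_def; apply/polyP => i; rewrite coef_poly.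
  by case: ltnP => // ni; rewrite nth_default // (leq_trans sg).
under eq_bigr => a _.
  rewrite gE coef_sum rmorph_sum mulr_sumr.
  over.
rewrite exchange_big mulr_sumr; apply: eq_bigr => i _.
under eq_bigr do rewrite coefZ rmorphM mulrCA.
rewrite -mulr_sumr dot_subX1_exp 1?mulrCA //.
by apply: leq_trans kjm; rewrite addnA leq_add2r leq_add2l leq_ord.
Qed.

(** * The weight and uniqueness for its Toeplitz systems *)

(** On the unit circle |1 - x|^(2k) = (-1)^k x^(-k) (x - 1)^(2k), so this multiplies by the weight
    up to a sign and a shift by [k]. The power is split because [dot_subX1_exp] supplies one of the
    halves. *)
Definition wmul (K : comNzRingType) (k : nat) (q : {poly K}) : {poly K} :=
  ('X - 1) ^+ k * (('X - 1) ^+ k * q).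

(* A polynomial meeting the hypotheses makes [(X - 1)^k f] orthogonal to
   itself. *)
Lemma toeplitz_unique (K : numClosedFieldType) (k n : nat) (f : {poly K}) :
  (size f <= n.+1)%N ->
  (forall i, (i <= n)%N -> f`_i = 0 \/ (wmul k f)`_(k + i) = 0) ->
  f = 0.
Proof.
move=> sf f0; pose g := ('X - 1) ^+ k * f.
(* The squared norm of [g] is, up to sign, the sum of conj(f_i) times the coefficient of [wmul k f]
   at k + i; either alternative of the hypothesis kills the term. *)
have g_dot : \sum_(a < (k + n).+1) g`_a * (g`_a)^* = 0.
  have := @dot_subX1_exp_mul K k 0 n (k + n) g f sf.
  rewrite mulr1 -/g => ->; last by rewrite addn0.
  rewrite big1 ?mulr0 // => i _; rewrite addn0.
  have [fi|gi] := f0 i (leq_ord i); first by rewrite fi rmorph0 mul0r.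
  by rewrite -/(wmul k f) gi mulr0.
apply/eqP; have : g == 0; last by rewrite mulf_eq0 (negPf (subX1_exp_neq0 _ _)).
apply/eqP/polyP => a; rewrite coef0.
case: (ltnP a (k + n).+1) => [akn|kna]; last first.
  rewrite nth_default //; apply: leq_trans kna; rewrite /g.
  apply: leq_trans (size_polyMleq _ _) _.
  by rewrite -polyC1 size_exp_XsubC addSn -[leqRHS]addnS leq_add2l.
move/eqP: g_dot; rewrite psumr_eq0; last by move=> *; rewrite mul_conjC_ge0.
by move=> /allP/(_ (Ordinal akn)); rewrite mem_index_enum mul_conjC_eq0 => /(_ isT)/eqP.
Qed.

(* [q] is the reversed Szego polynomial of degree [n] for the weight
   |1 - x|^(2k): up to a sign the coefficients of [wmul k q] are the moments
   of [q] shifted by [k]. *)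
Definition rev_szego (K : comNzRingType) (k n : nat) (q : {poly K}) : Prop :=
  [/\ (size q <= n.+1)%N, q`_0 = 1 &
      forall i, (1 <= i <= n)%N -> (wmul k q)`_(k + i) = 0].

(** * Differential relations between consecutive reversed Szego polynomials *)

Lemma coefXderiv (K : comNzRingType) (p : {poly K}) i :
  ('X * p^`())`_i = i%:R * p`_i.
Proof. by rewrite coefXM; case: i => [|i]; rewrite ?mul0r // coef_deriv mulr_natl. Qed.

Lemma coef_derivE (K : comNzRingType) (p : {poly K}) i :
  (p^`())`_i = i.+1%:R * p`_i.+1.
Proof. by rewrite coef_deriv mulr_natl. Qed.

Lemma subX1_deriv_exp (K : comNzRingType) (k : nat) :
  ('X - 1) * ((('X - 1) ^+ k)^`() : {poly K}) = k%:R * ('X - 1) ^+ k.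
Proof.
rewrite deriv_exp derivB derivX derivC subr0 mul1r -mulr_natl mulrCA.
by case: k => [|k]; rewrite ?mul0r //= -exprS.
Qed.

(** The factor [1 - 'X] restores the power of ['X - 1] lost in differentiating the weight, so
    everything is again a [wmul]. *)
Lemma wmul_deriv (K : comNzRingType) k (q : {poly K}) :
  (1 - 'X) * (wmul k q)^`() =
  wmul k ((1 - 'X) * q^`()) - (2 * k)%:R * wmul k q.
Proof.
rewrite /wmul !derivM; have := subX1_deriv_exp K k.
set P := _ ^+ k; set P' := P^`() => PE.
have -> : (1 - 'X) * (P' * (P * q) + P * (P' * q + P * q^`())) =
  - (2 * (('X - 1) * P') * P * q) + P * P * ((1 - 'X) * q^`()) by ring.
by rewrite PE; ring.
Qed.

Lemma rev_szego_up (K : numClosedFieldType) k n (q q' : {poly K}) :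
  rev_szego k n q -> rev_szego k n.+1 q' ->
  (n + k).+1%:R * q' = ((n + k).+1%:R + k%:R * 'X) * q - 'X * (1 - 'X) * q^`().
Proof.
move=> [sq q0 oq] [sq' q0' oq']; apply/esym/eqP; rewrite -subr_eq0; apply/eqP.
set f := (X in X = 0).
have fE : f = (n + k).+1%:R%:P * q + k%:R%:P * ('X * q) - 'X * q^`()
    + 'X * ('X * q^`()) - (n + k).+1%:R%:P * q'.
  by rewrite /f !rmorph_nat; ring.
have dfE : wmul k f =
    (n + k).+1%:R%:P * wmul k q - k%:R%:P * ('X * wmul k q)
    - 'X * (wmul k q)^`() + 'X * ('X * (wmul k q)^`())
    - (n + k).+1%:R%:P * wmul k q'.
  have := wmul_deriv k q.
  rewrite /f !rmorph_nat /wmul; set E := _ ^+ k * (_ ^+ k * q) => dE.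
  transitivity ((n + k).+1%:R * E - k%:R * ('X * E) - 'X * ((1 - 'X) * E^`())
    - (n + k).+1%:R * (('X - 1) ^+ k * (('X - 1) ^+ k * q'))); last by ring.
  by rewrite dE /E; ring.
apply: (toeplitz_unique (k := k) (n := n.+1)).
  apply/leq_sizeP => -[//|j] nj.
  rewrite fE !(coefD, coefN) !coefCM
    [('X * ('X * _))`_ _]coefXM !coefXderiv ?coefXM /=.
  have qj : q`_j = 0 by rewrite nth_default // (leq_trans sq).
  have qj1 : q`_j.+1 = 0 by rewrite nth_default // (leq_trans sq) // leqW.
  have qj' : q'`_j.+1 = 0 by rewrite nth_default // (leq_trans sq').
  by rewrite qj qj1 qj'; ring.
case=> [_|i ni]; [left|right].
  by rewrite fE !(coefD, coefN) !coefCM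
    [('X * ('X * _))`_ _]coefXM !coefXderiv ?coefXM /= q0 q0'; ring.
rewrite -/(wmul k f) dfE !(coefD, coefN) !coefCM
    [('X * ('X * _))`_ _]coefXM !coefXderiv ?coefXM addnS /=.
have -> : (wmul k q')`_(k + i).+1 = 0 by rewrite -addnS oq'.
(* Orthogonality says nothing about the moments at 0 and n + 1; there the numerical factors i and n
   - i vanish instead. *)
have ei : i%:R * (wmul k q)`_(k + i) = 0.
  by case: i ni => [|i] ni; rewrite ?mul0r // oq ?mulr0.
have ei1 : (n%:R - i%:R) * (wmul k q)`_(k + i).+1 = 0.
  have [lin|nli] := ltnP i n; last first.
    by rewrite (_ : i = n) ?subrr ?mul0r //; apply/eqP; rewrite eqn_leq nli andbT.
  by rewrite -addnS oq ?mulr0.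
transitivity ((n%:R - i%:R) * (wmul k q)`_(k + i).+1
  + i%:R * (wmul k q)`_(k + i)); last by rewrite ei ei1 addr0.
by rewrite -(addn1 (n + k)) -(addn1 (k + i)) !natrD; ring.
Qed.

Lemma rev_szego_down (K : numClosedFieldType) k n (q q' : {poly K}) :
  rev_szego k n q -> rev_szego k n.+1 q' ->
  exists2 g : K, (1 - 'X) * q'^`() + n.+1%:R * q' = g%:P * q &
    (n + k).+1%:R * (wmul k q')`_k = g * (wmul k q)`_k.
Proof.
(* The value of [g] is forced by comparing constant terms, both polynomials being 1 at 0. *)
move=> [sq q0 oq] [sq' q0' oq']; pose g := q'`_1 + n.+1%:R.
pose f := (1 - 'X) * q'^`() + n.+1%:R * q' - g%:P * q.
have fE : f = q'^`() - 'X * q'^`() + n.+1%:R%:P * q' - g%:P * q.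
  by rewrite /f !rmorph_nat; ring.
have dfE : wmul k f = (wmul k q')^`() - 'X * (wmul k q')^`()
    + (2 * k + n.+1)%:R%:P * wmul k q' - g%:P * wmul k q.
  have := wmul_deriv k q'.
  rewrite /f !rmorph_nat /wmul; set E := _ ^+ k * (_ ^+ k * q') => dE.
  transitivity ((1 - 'X) * E^`() + (2 * k + n.+1)%:R * E
    - g%:P * (('X - 1) ^+ k * (('X - 1) ^+ k * q))); last by ring.
  by rewrite dE /E; ring.
have dfi i : (wmul k f)`_(k + i) =
    (k + i).+1%:R * (wmul k q')`_(k + i.+1)
    + (k%:R + n.+1%:R - i%:R) * (wmul k q')`_(k + i) - g * (wmul k q)`_(k + i).
  rewrite dfE !(coefD, coefN) !coefCM coefXderiv coef_derivE !addnS.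
  by ring.
have f0 : f = 0.
  apply: (toeplitz_unique (k := k) (n := n)).
    apply/leq_sizeP => j nj.
    rewrite fE !(coefD, coefN) !coefCM coefXderiv coef_derivE.
    have -> : q`_j = 0 by rewrite nth_default // (leq_trans sq).
    have -> : q'`_j.+1 = 0 by rewrite nth_default // (leq_trans sq').
    (* In degree n + 1 the derivative term contributes -(n + 1) times the leading coefficient, which
       the multiple [n.+1] of [q'] cancels. *)
    move: nj; rewrite leq_eqVlt => /predU1P[<-|nj]; first by ring.
    by rewrite (nth_default _ (leq_trans sq' nj)); ring.
  case=> [_|i ni]; [left|right].
    rewrite fE !(coefD, coefN) !coefCM coefXderiv coef_derivE q0 q0' /g.
    by ring.
  rewrite -/(wmul k f) dfi (oq' i.+2) // (oq' i.+1) ?(oq i.+1) ?(leqW ni) // !mulr0.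
  by ring.
exists g; first by apply/eqP; rewrite -subr_eq0 -/f f0.
(* The second relation is the coefficient of x^k in [wmul k f = 0]. *)
apply/eqP; rewrite -subr_eq0; apply/eqP; have := dfi 0%N.
rewrite f0 /wmul !mulr0 coef0 -/(wmul k q) -/(wmul k q') oq' //.
rewrite !addn0 => E; rewrite [RHS]E.
by rewrite -(addn1 (n + k)) -(addn1 n) !natrD; ring.
Qed.

Lemma rev_szego_sqr_rec (K : numClosedFieldType) k n (q q' : {poly K}) (m : nat) :
  rev_szego k n q -> rev_szego k n.+1 q' ->
  (wmul k q)`_k != 0 -> (wmul k q')`_k != 0 ->
  let h i := (wmul k q * q)`_i / (wmul k q)`_k in
  let h' i := (wmul k q' * q')`_i / (wmul k q')`_k in
  m.+2%:R * h' m.+2 =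
    (2 * (n%:R + k%:R) + 1 - m%:R) * h m.+1 + m%:R * h m
    - (2 * (n%:R + k%:R) + 1 - m%:R) * h' m.+1.
Proof.
move=> Hq Hq' N0 N0'; move: (rev_szego_up Hq Hq') (rev_szego_down Hq Hq').
move=> up [g down gE].
set N := (wmul k q)`_k in N0 gE *; set N' := (wmul k q')`_k in N0' gE *.
move=> h h'.
pose H := N^-1%:P * (wmul k q * q); pose H' := N'^-1%:P * (wmul k q' * q').
(* With this, both sides of [HE] reduce to the same multiple of (x - 1)^(2k) q q', and [g]
   disappears. *)
have gN : g * N'^-1 = (n + k).+1%:R * N^-1.
  by apply: (mulIf N0); apply: (mulIf N0'); rewrite (mulrAC g) !mulfVK // gE.
have HE : (1 - 'X) * H'^`() + (2 * (n + k).+1)%:R * H' =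
    (2 * (n + k).+1)%:R * H - 'X * (1 - 'X) * H^`().
  pose P : {poly K} := ('X - 1) ^+ k.
  have T_ p : (1 - 'X) * (wmul k p * p)^`() =
      P * P * p * (2 * ((1 - 'X) * p^`()) - (2 * k)%:R * p).
    have := wmul_deriv k p; rewrite derivM mulrDr [_ * (_^`() * p)]mulrA => ->.
    by rewrite /wmul -/P; ring.
  rewrite /H /H' ![(_%:P * _)^`()]derivM !derivC !mul0r !add0r.
  transitivity (N'^-1%:P * (2 * P * P * q' * ((1 - 'X) * q'^`() + n.+1%:R * q'))).
    rewrite [(1 - 'X) * (_%:P * _)]mulrCA T_ /wmul -/P.
    by rewrite -(addn1 n) -(addn1 (n + k)) !natrD; ring.
  rewrite down.
  transitivity ((g * N'^-1)%:P * (2 * P * P * q' * q)); first by rewrite polyCM; ring.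
  rewrite gN polyCM rmorph_nat.
  transitivity (N^-1%:P * (2 * P * P * q * ((n + k).+1%:R * q'))); first by ring.
  rewrite up.
  rewrite -[_ * _ * (_%:P * _)]mulrA [(1 - 'X) * (_%:P * _)]mulrCA T_ /wmul -/P.
  by ring.
have cH i : H`_i = h i by rewrite /H coefCM mulrC.
have cH' i : H'`_i = h' i by rewrite /H' coefCM mulrC.
clearbody H H' h h'; have := congr1 (fun p : {poly K} => p`_m.+1) HE.
have -> : (1 - 'X) * H'^`() + (2 * (n + k).+1)%:R * H' =
    H'^`() - 'X * H'^`() + (2 * (n + k).+1)%:R%:P * H' by rewrite rmorph_nat; ring.
have -> : (2 * (n + k).+1)%:R * H - 'X * (1 - 'X) * H^`() =
   (2 * (n + k).+1)%:R%:P * H - 'X * H^`() + 'X * ('X * H^`()).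
  by rewrite rmorph_nat; ring.
rewrite !(coefD, coefN) !coefCM
    [('X * ('X * _))`_ _]coefXM !coefXderiv ?coefXM coef_derivE /= !cH !cH' => E.
have {E} E : m.+2%:R * h' m.+2 = m.+1%:R * h' m.+1 - (2 * (n + k).+1)%:R * h' m.+1
    + ((2 * (n + k).+1)%:R * h m.+1 - m.+1%:R * h m.+1 + m%:R * h m).
  by rewrite -E; ring.
by rewrite E -(addn1 m) -(addn1 (n + k)) !(natrD, natrM); ring.
Qed.

(** * Homogenization in two variables *)

(* The form of degree [m] in [z = 'X] and [w = 'Y] that dehomogenizes to [f] at
   [w = 1]; coefficients of [f] beyond degree [m] are dropped. *)
Definition homog (K : comNzRingType) (m : nat) (f : {poly K}) : {poly {poly K}} :=
  \poly_(a < m.+1) (f`_a *: 'X^(m - a)).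

Lemma coef_homog (K : comNzRingType) m (f : {poly K}) a b :
  (homog m f)`_a`_b = (f`_a) *+ (a + b == m)%N.
Proof.
rewrite coef_poly ltnS; case: leqP => [am|ma]; last first.
  by rewrite coef0 (_ : (_ == _) = false) //; lia.
rewrite coefZ coefXn mulr_natr; congr (_ *+ nat_of_bool _).
by apply/eqP/eqP; lia.
Qed.

Lemma poly2P (K : comNzRingType) (p q : {poly {poly K}}) :
  (forall a b, p`_a`_b = q`_a`_b) -> p = q.
Proof. by move=> pq; apply/polyP => a; apply/polyP => b. Qed.

Lemma homog1 (K : comNzRingType) : homog 0 (1 : {poly K}) = 1.
Proof.
apply: poly2P => a b; rewrite coef_homog !coef1 addn_eq0.
by case: a => [|a]; rewrite /= ?mul0rn ?coef0 ?coef1.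
Qed.

Lemma homogMX (K : comNzRingType) m (f : {poly K}) :
  homog m f * 'X = homog m.+1 (f * 'X).
Proof.
apply: poly2P => a b; rewrite coef_homog !coefMX.
by case: a => [|a]; rewrite ?coef0 ?mul0rn //= coef_homog.
Qed.

(** The size bound ensures that [homog m] has not dropped a coefficient that [homog m.+1] keeps. *)
Lemma homogMY (K : comNzRingType) m (f : {poly K}) : (size f <= m.+1)%N ->
  homog m f * 'Y = homog m.+1 f.
Proof.
move=> sf; apply: poly2P => a b; rewrite coef_homog coefMC coefMX.
case: b => [|b]; last by rewrite /= coef_homog addnS.
by rewrite addn0 /=; case: eqP => // ->; rewrite nth_default.
Qed.

Lemma homogB (K : comNzRingType) m (f g : {poly K}) :
  homog m (f - g) = homog m f - homog m g.
Proof.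
by apply: poly2P => a b; rewrite !(coefD, coefN) !coef_homog coefB mulrnBl.
Qed.

Lemma homogZ (K : comNzRingType) m c (f : {poly K}) :
  c%:P *: homog m f = homog m (c *: f).
Proof.
by apply: poly2P => a b; rewrite coefZ coefCM !coef_homog coefZ mulrnAr.
Qed.

Lemma homog_sum (K : comNzRingType) m (I : finType) (F : I -> {poly K}) :
  homog m (\sum_i F i) = \sum_i homog m (F i).
Proof.
apply: poly2P => a b; rewrite coef_homog !coef_sum -sumrMnl.
by apply: eq_bigr => i _; rewrite coef_homog.
Qed.

Lemma homogMXn (K : comNzRingType) m j (f : {poly K}) :
  homog m f * 'X^j = homog (m + j) (f * 'X^j).
Proof.
elim: j => [|j IH]; first by rewrite !mulr1 addn0.
by rewrite exprSr mulrA IH homogMX addnS exprSr mulrA.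
Qed.

Lemma homogMYn (K : comNzRingType) m j (f : {poly K}) : (size f <= m.+1)%N ->
  homog m f * 'Y ^+ j = homog (m + j) f.
Proof.
move=> sf; elim: j => [|j IH]; first by rewrite mulr1 addn0.
by rewrite exprSr mulrA IH homogMY ?addnS // (leq_trans sf) // ltnS leq_addr.
Qed.

Lemma size_subX1_exp (K : comNzRingType) k :
  size (('X - 1) ^+ k : {poly K}) = k.+1.
Proof. by rewrite -polyC1 size_exp_XsubC. Qed.

Lemma homog_subX1_exp (K : comNzRingType) k :
  homog k (('X - 1) ^+ k : {poly K}) = ('X - 'Y) ^+ k.
Proof.
elim: k => [|k IH]; first by rewrite !expr0 homog1.
rewrite !exprSr mulrBr mulr1 homogB -homogMX -homogMY ?IH -?mulrBr //.
by rewrite size_subX1_exp.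
Qed.

Lemma pkmonE (R : realType) k n i : (i <= n)%N ->
  pkmon R k n i = homog (n + k) (('X - 1) ^+ k * 'X^i).
Proof.
move=> ni; rewrite /pkmon /pk -homog_subX1_exp homogMXn homogMYn.
  by congr homog; lia.
apply: (leq_trans (size_polyMleq _ _)).
by rewrite size_subX1_exp size_polyXn addnS.
Qed.

(** The square partial sums are constant beyond [m], and row [a] contributes only at b = m - a. *)
Lemma pdot_homog (R : realType) m (f g : {poly complexC R}) :
  pdot (homog m f) (homog m g) = \sum_(a < m.+1) f`_a * (g`_a)^*.
Proof.
apply: lim_near_cst => //; exists m.+1 => // N /= mN.
rewrite [RHS](big_ord_widen N (fun a => f`_a * (g`_a)^*)) // [RHS]big_mkcond.
apply: eq_bigr => a _; rewrite ltnS.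
case: leqP => [am|ma]; last first.
  by apply: big1 => b _; rewrite coef_homog (_ : (_ == _) = false) ?mul0r //; lia.
have bN : (m - a < N)%N by apply: leq_trans mN; rewrite ltnS leq_subr.
rewrite (bigD1 (Ordinal bN)) //= big1 ?addr0 => [|b].
  by rewrite !coef_homog subnKC // eqxx.
rewrite -val_eqE /= => bm; rewrite coef_homog (_ : (_ == _) = false) ?mul0r //.
by apply/eqP => abm; case/eqP: bm; rewrite -abm addKn.
Qed.

(** * Toeplitz structure of the Gram matrices and their cofactors *)

Lemma gramAE (R : realType) k n (i j : 'I_n.+1) :
  gramA R k n i j = (-1) ^+ k * (wmul k 'X^i)`_(k + j).
Proof.
rewrite mxE (pkmonE R k (leq_ord i)) (pkmonE R k (leq_ord j)) pdot_homog.
by rewrite dot_subX1_exp; [reflexivity | rewrite addnC leq_add2r leq_ord].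
Qed.

Lemma wmulXn (K : comNzRingType) k i :
  wmul k 'X^i = ('X - 1) ^+ (k + k) * 'X^i :> {poly K}.
Proof. by rewrite /wmul mulrA -exprD. Qed.

(** Palindromy of (x - 1)^(2k). The hypothesis covers both transposition and the reversal of both
    indices. *)
Lemma coef_wmulXn_sym (K : comNzRingType) k i j i' j' : (i + i' = j + j')%N ->
  (wmul k ('X^i : {poly K}))`_(k + j) = (wmul k ('X^i' : {poly K}))`_(k + j').
Proof.
move=> ij; rewrite !wmulXn !coefMXn.
case: ltnP => [h|h]; case: ltnP => [h'|h'] //.
- by rewrite coef_subX1_exp_gt //; lia.
- by rewrite coef_subX1_exp_gt //; lia.
have -> : (k + j - i = k + k - (k + j' - i'))%N by lia.
rewrite coef_subX1_exp_rev; last by lia.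
by rewrite -signr_odd oddD addbb mul1r.
Qed.

Lemma conj_gramA (R : realType) k n : map_mx Num.conj (gramA R k n) = gramA R k n.
Proof.
apply/matrixP => i j; rewrite mxE !gramAE rmorphM rmorph_sign wmulXn coefMXn.
by congr (_ * _); case: ifP => _; [exact: rmorph0 | exact: conj_coef_subX1_exp].
Qed.

Lemma gramA_sym (R : realType) k n i j : gramA R k n i j = gramA R k n j i.
Proof.
by rewrite !gramAE; congr (_ * _); apply: coef_wmulXn_sym; rewrite addnC.
Qed.

Lemma gramA_rev (R : realType) k n i j :
  gramA R k n (rev_ord i) (rev_ord j) = gramA R k n i j.
Proof.
rewrite !gramAE; congr (_ * _); apply: coef_wmulXn_sym.
by rewrite /= !subSS !subnK ?leq_ord.
Qed.

Lemma coef_sum_ordXn (K : comNzRingType) n (c : 'I_n -> K) (i : 'I_n) :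
  (\sum_l c l *: 'X^l)`_i = c i.
Proof.
rewrite coef_sum (bigD1 i) //= coefZ coefXn eqxx mulr1 big1 ?addr0 // => l.
by rewrite -val_eqE eq_sym => /negPf li; rewrite coefZ coefXn li mulr0.
Qed.

Lemma size_sum_ordXn (K : comNzRingType) n (c : 'I_n -> K) :
  (size (\sum_l c l *: 'X^l : {poly K})%R <= n)%N.
Proof.
apply: (leq_trans (size_sum _ _ _)); apply/bigmax_leqP => l _.
by rewrite (leq_trans (size_scale_leq _ _)) // size_polyXn.
Qed.

Lemma wmulZ (K : comNzRingType) k c (q : {poly K}) :
  wmul k (c *: q) = c *: wmul k q.
Proof. by rewrite /wmul -!scalerAr. Qed.

Lemma coef_wmul_sum (R : realType) k n (c : 'I_n.+1 -> complexC R) (j : 'I_n.+1) :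
  (-1) ^+ k * (wmul k (\sum_l c l *: 'X^l))`_(k + j) =
  \sum_l c l * gramA R k n l j.
Proof.
rewrite {1}/wmul !mulr_sumr coef_sum mulr_sumr; apply: eq_bigr => l _.
by rewrite -/(wmul k (c l *: 'X^l)) wmulZ gramAE coefZ mulrCA.
Qed.

(** A kernel vector, read as a coefficient list, is a polynomial whose moments all vanish. *)
Lemma det_gramA_neq0 (R : realType) k n : \det (gramA R k n) != 0.
Proof.
apply/det0P => -[v v0 vA]; case/eqP: v0; apply/rowP => i; rewrite mxE.
rewrite -(coef_sum_ordXn (fun l => v ord0 l)).
rewrite (_ : \sum_l _ = 0) ?coef0 //.
apply: (toeplitz_unique (k := k) (size_sum_ordXn _)) => j; rewrite -ltnS => jn.
right; have sk : (-1) ^+ k != 0 :> complexC R by rewrite signr_eq0.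
apply: (mulfI sk); rewrite mulr0.
have := coef_wmul_sum k (fun l => v ord0 l) (Ordinal jn); rewrite /wmul /= => ->.
by have /rowP/(_ (Ordinal jn)) := vA; rewrite !mxE.
Qed.

Lemma gramD_neq0 (R : realType) k n : gramD R k n != 0.
Proof. by case: n => [|n]; rewrite ?oner_neq0 // det_gramA_neq0. Qed.

Lemma conj_gramD (R : realType) k n : (gramD R k n)^* = gramD R k n.
Proof.
case: n => [|n] /=; first by rewrite rmorph1.
by rewrite -det_map_mx conj_gramA.
Qed.

Lemma sum_cofactor_gramA (R : realType) k n (i j : 'I_n.+1) :
  \sum_l cofactor (gramA R k n) i l * gramA R k n l j = gramD R k n.+1 *+ (j == i).
Proof.
have /matrixP/(_ j i) := mul_mx_adj (gramA R k n).
rewrite mxE [in RHS]mxE => <-; apply: eq_bigr => l _.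
by rewrite (gramA_sym R k l j) mulrC; congr (_ * _); rewrite mxE.
Qed.

(** By persymmetry, the last cofactor row and the reversed first one have the same product with the
    nonsingular Gram matrix. Hence [psi] is the reversal of [phi]. *)
Lemma cofactor_gramA_rev (R : realType) k n l :
  cofactor (gramA R k n) ord_max l = cofactor (gramA R k n) ord0 (rev_ord l).
Proof.
pose u := \row_l (cofactor (gramA R k n) ord_max l -
                  cofactor (gramA R k n) ord0 (rev_ord l)).
suff /rowP/(_ l) : u = 0 by rewrite !mxE => /eqP; rewrite subr_eq0 => /eqP.
apply/eqP; apply: contraT => u0; have /negP[] := det_gramA_neq0 R k n.
apply/det0P; exists u => //; apply/rowP => j; rewrite !mxE.
under eq_bigr do rewrite mxE mulrBl.
rewrite sumrB sum_cofactor_gramA (reindex_inj rev_ord_inj) /=.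
under eq_bigr => i _ do rewrite rev_ordK -[X in _ * gramA _ _ _ _ X]rev_ordK gramA_rev.
rewrite sum_cofactor_gramA; apply/eqP; rewrite subr_eq0; apply/eqP.
congr (_ *+ nat_of_bool _); rewrite -!val_eqE /= subSS subn_eq0.
by rewrite eqn_leq leq_ord.
Qed.

Lemma cofactor_gramA00 (R : realType) k n :
  cofactor (gramA R k n) ord0 ord0 = gramD R k n.
Proof.
rewrite /cofactor /= expr0 mul1r; case: n => [|n]; first by rewrite det_mx00.
congr (\det _); apply/matrixP => i j; rewrite 2![LHS]mxE !gramAE.
congr (_ * _); rewrite !wmulXn !coefMXn /= /bump !leq0n !add1n addnS.
by rewrite ltnS subSS.
Qed.

(** * Reversed Szego polynomials from cofactors *)

(** The divisor is the (0,0) cofactor, which makes the constant term 1. *)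
Definition szego_poly (R : realType) k n : {poly complexC R} :=
  (gramD R k n)^-1 *: \sum_l cofactor (gramA R k n) ord0 l *: 'X^l.

Lemma coef_wmul_szego (R : realType) k n (j : 'I_n.+1) :
  (-1) ^+ k * (wmul k (szego_poly R k n))`_(k + j) =
  (gramD R k n.+1 / gramD R k n) *+ (j == ord0).
Proof.
rewrite wmulZ coefZ mulrCA coef_wmul_sum sum_cofactor_gramA.
by rewrite mulrnAr mulrC.
Qed.

Lemma szego_polyP (R : realType) k n : rev_szego k n (szego_poly R k n).
Proof.
split=> [||i /andP[i0 iN]].
- exact: (leq_trans (size_scale_leq _ _) (size_sum_ordXn _)).
- rewrite coefZ (coef_sum_ordXn _ (ord0 : 'I_n.+1)) cofactor_gramA00.
  by rewrite mulVf // gramD_neq0.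
have sk : (-1) ^+ k != 0 :> complexC R by rewrite signr_eq0.
rewrite -ltnS in iN; apply: (mulfI sk).
rewrite mulr0 (coef_wmul_szego R k (Ordinal iN)) -val_eqE /=.
by rewrite eqn0Ngt i0.
Qed.

(** The ratio is the squared norm of (x - 1)^k q_n: by orthogonality only the constant term of q_n
    survives in the pairing. *)
Lemma gramD_ratio_gt0 (R : realType) k n : 0 < gramD R k n.+1 / gramD R k n.
Proof.
have [sq q0 oq] := szego_polyP R k n; set q := szego_poly R k n in sq q0 oq.
rewrite lt_neqAle eq_sym mulf_neq0 ?invr_neq0 ?gramD_neq0 //=.
have := @dot_subX1_exp_mul _ k 0 n (k + n) (('X - 1) ^+ k * q) q sq.
rewrite mulr1 addn0 leqnn => /(_ isT).
rewrite [in RHS]big_ord_recl [in RHS]big1 ?addr0 => [|i _]; last first.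
  by rewrite addn0 -/(wmul k q) oq ?mulr0 //= ltnS.
rewrite q0 rmorph1 mul1r -/(wmul k q) (coef_wmul_szego R k (ord0 : 'I_n.+1)).
rewrite mulr1n => <-; apply: sumr_ge0 => a _; exact: mul_conjC_ge0.
Qed.

(** * The numbers [alpha] as polynomial coefficients *)

Lemma sum_pkmonE (R : realType) k n (c : 'I_n.+1 -> complexC R) :
  \sum_l (c l)%:P *: pkmon R k n l =
  homog (n + k) (('X - 1) ^+ k * \sum_l c l *: 'X^l).
Proof.
rewrite mulr_sumr homog_sum; apply: eq_bigr => l _.
by rewrite pkmonE ?leq_ord // homogZ scalerAr.
Qed.

Lemma pdot_homog_shift (R : realType) m j (f g : {poly complexC R}) :
  (size f <= m.+1)%N ->
  pdot ('Y ^+ j * homog m f) ('X^j * homog m g) =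
  \sum_(a < (m + j).+1) f`_a * ((g * 'X^j)`_a)^*.
Proof.
by move=> sf; rewrite -pdot_homog -homogMXn -homogMYn // mulrC ['X^j * _]mulrC.
Qed.

(** Since conjugating [g] reverses [f], the correlation of the two becomes a convolution of
    [wmul k f] with [f]. *)
Lemma dot_subX1_reversal (K : numClosedFieldType) k n j (c : K) (f g : {poly K}) :
  (size f <= n.+1)%N -> (size g <= n.+1)%N ->
  (forall i, (i <= n)%N -> (g`_i)^* = f`_(n - i)) ->
  \sum_(a < (n + k + j).+1)
    (c *: (('X - 1) ^+ k * f))`_a * ((c *: (('X - 1) ^+ k * g) * 'X^j)`_a)^* =
  c * c^* * ((-1) ^+ k * (wmul k f * f)`_(n + k + j)).
Proof.
move=> sf sg fg; pose P : {poly K} := ('X - 1) ^+ k.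
transitivity (c * c^* * \sum_(a < (n + k + j).+1) (P * f)`_a * ((P * g * 'X^j)`_a)^*).
  rewrite mulr_sumr; apply: eq_bigr => a _.
  by rewrite -scalerAl !coefZ rmorphM mulrACA.
congr (_ * _); rewrite (dot_subX1_exp_mul _ sg); last by rewrite (addnC n).
congr (_ * _); rewrite coefMr -/(wmul k f); set E := wmul k f.
have -> : \sum_(i < (n + k + j).+1) E`_(n + k + j - i) * f`_i =
   \sum_(i < n.+1) E`_(n + k + j - i) * f`_i.
  have nkj : (n.+1 <= (n + k + j).+1)%N by rewrite ltnS -addnA leq_addr.
  rewrite (big_ord_widen _ (fun i => E`_(n + k + j - i) * f`_i) nkj).
  rewrite [RHS]big_mkcond; apply: eq_bigr => i _.
  by case: ltnP => // ni; rewrite [f`_i]nth_default ?mulr0 // (leq_trans sf).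
rewrite [RHS](reindex_inj rev_ord_inj) /=; apply: eq_bigr => i _.
have ni := leq_ord i; rewrite mulrC fg // subSS; congr (_`_ _ * _); lia.
Qed.

Lemma wmul_sqrZ (K : comNzRingType) k c (q : {poly K}) :
  wmul k (c *: q) * (c *: q) = (c * c) *: (wmul k q * q).
Proof. by rewrite wmulZ -scalerAl -scalerAr scalerA. Qed.

Lemma alphaE (R : realType) k n j :
  alpha R k n j =
  (wmul k (szego_poly R k n) * szego_poly R k n)`_(n + k + j) /
  (wmul k (szego_poly R k n))`_k.
Proof.
set q := szego_poly R k n; pose x := gramD R k n * gramD R k n.+1.
have D0 := gramD_neq0 R k n; have D0' := gramD_neq0 R k n.+1.
(* Positivity gives |sqrtC x|^2 = x; here x = |D_n|^2 (D_(n+1) / D_n), as D_n is real. *)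
have x_gt0 : 0 < x.
  have -> : x = gramD R k n * (gramD R k n)^* * (gramD R k n.+1 / gramD R k n).
    by rewrite conj_gramD /x mulrACA divff // mulr1.
  by rewrite mulr_gt0 ?gramD_ratio_gt0 // mul_conjC_gt0.
have xc : (sqrtC x)^-1 * ((sqrtC x)^-1)^* = x^-1.
  by rewrite -normCK normfV exprVn -normrX sqrtCK gtr0_norm.
rewrite /alpha /phi /psi !sum_pkmonE !homogZ -/x pdot_homog_shift; last first.
  rewrite (leq_trans (size_scale_leq _ _)) // (leq_trans (size_polyMleq _ _)) //.
  rewrite size_subX1_exp addSn /= (addnC n) -addnS leq_add2l.
  exact: size_sum_ordXn.
rewrite dot_subX1_reversal ?size_sum_ordXn //; last first.
  move=> i; rewrite -ltnS => iN.
  rewrite (coef_sum_ordXn _ (Ordinal iN)) cofactor_gramA_rev.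
  rewrite -cofactor_map_mx conj_gramA.
  by rewrite -(coef_sum_ordXn _ (rev_ord _)) /= subSS.
have qE : \sum_l cofactor (gramA R k n) ord0 l *: 'X^l = gramD R k n *: q.
  by rewrite scalerA mulfV // scale1r.
have e0 : (-1) ^+ k * (wmul k q)`_k = gramD R k n.+1 / gramD R k n.
  by have := coef_wmul_szego R k (ord0 : 'I_n.+1); rewrite addn0 mulr1n.
have -> : (wmul k q)`_k = (-1) ^+ k * (gramD R k n.+1 / gramD R k n).
  by rewrite -e0 mulrA -expr2 sqrr_sign mul1r.
rewrite xc qE wmul_sqrZ coefZ [((-1) ^+ k * _)^-1]invfM invr_sign /x.
move: {+}(_ ^+ k) {+}(_ `_ _) (gramD R k n) (gramD R k n.+1) D0 D0' => s h D D' D0 D0'.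
by field; rewrite D0 D0'.
Qed.

Theorem theorem4p1 (R : realType) (k : nat) (hk : (1 <= k)%N) (j n : nat)
  (hj : (1 <= j)%N) (hn : (maxn 0 (j - k) <= n)%N) :
  (n%:R + k%:R + j%:R + 2) * alpha R k n.+1 j.+1 =
    (n%:R - j%:R + k%:R + 1) * alpha R k n j.+1
    + (n%:R + k%:R + j%:R) * alpha R k n j
    - (n%:R - j%:R + k%:R + 1) * alpha R k n.+1 j.
Proof.
have e0 m : (wmul k (szego_poly R k m))`_k != 0.
  have : gramD R k m.+1 / gramD R k m != 0 by rewrite lt0r_neq0 // gramD_ratio_gt0.
  have := coef_wmul_szego R k (ord0 : 'I_m.+1); rewrite addn0 mulr1n => <-.
  by rewrite mulf_eq0 signr_eq0.
(* For m = n + k + j the factor 2(n + k) + 1 - m is n - j + k + 1. *)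
have := rev_szego_sqr_rec (n + k + j) (szego_polyP R k n) (szego_polyP R k n.+1)
  (e0 n) (e0 n.+1).
rewrite /= !alphaE !(addSn, addnS) => E.
have -> : n%:R + k%:R + j%:R + 2 = (n + k + j).+2%:R :> complexC R.
  by rewrite -(addn2 (n + k + j)) !natrD.
by rewrite E !natrD; ring.
Qed.
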